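(* Let $K$ be a field, let $f = x^C(x^A - \rho x^B) \in K[x_1,\dots,x_n]$ with $\rho \in K^\times$ and $A,B,C \in \mathbb{Z}_{\ge 0}^n$ such that $A_iB_i = 0$ for all $i \in \{1,\dots,n\}$, and set $g := x^A - \rho x^B$. Suppose that $f$ satisfies condition (N) of the context, let $\iota(g) = (\alpha,\mathfrak a,\beta,\mathfrak b)$, let $j_1,j_2\in\{1,\dots,n\}$ be such that $A_{j_1} = \alpha$ and $B_{j_2} = \beta$, and put $I := \{j_1,j_2\}$. Let $\pi : \mathrm{Bl}_{D_I}(\mathbb{A}^n_K) \to \mathbb{A}^n_K$ be the blowup with center $D_I := V(x_{j_1},x_{j_2})$. Then in every standard chart $D_+(X_j) \cong \mathbb{A}^n_K$, $j \in I$, with coordinates $x' = (x_1',\dots,x_n')$, writing the total transform of $f$ as $x'^{C'}(x'^{A'} - \rho x'^{B'})$ with $A_i'B_i' = 0$ for all $i$ and setting $g' := x'^{A'} - \rho x'^{B'}$, we have $$\iota(g') <_{\mathrm{lex}} \iota(g).$$ In particular, the local monomialization process terminates if in every non-final chart, with data $(A,B,C)$, the center is chosen as $D_I = V(x_{j_1},x_{j_2})$ with $I = \{j_1,j_2\}$ for arbitrary $j_1,j_2\in\{1,\dots,n\}$ satisfying $A_{j_1} = \max_i A_i$ and $B_{j_2} = \max_i B_i$.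
   Context: Notation: for $A=(A_1,\dots,A_n)\in\mathbb{Z}_{\ge0}^n$, $x^A := x_1^{A_1}\cdots x_n^{A_n}$ and $|A| := \sum_{i=1}^n A_i$. Invariant: for $g = x^A - \rho x^B$ as in the claim (with a fixed order $(A,B)$ of the two monomials), $\alpha(g):=\max_i A_i$, $\mathfrak a(g) := \#\{i \mid A_i = \alpha(g)\}$, $\beta(g) := \max_i B_i$, $\mathfrak b(g) := \#\{i\mid B_i = \beta(g)\}$ (with $i$ ranging over $\{1,\dots,n\}$), and $\iota(g) := (\alpha(g),\mathfrak a(g),\beta(g),\mathfrak b(g)) \in\mathbb{Z}_{\ge0}^4$, with $\mathbb{Z}_{\ge0}^4$ ordered lexicographically. For $g'$ one uses the pair $(A',B')$ in this order. Conditions: for $f = x^C(x^A - \rho x^B)$ with $A_iB_i=0$ for all $i$, condition (M) is: either $\min\{|A|,|B|\} = 0$, or there is an index $i$ with $C_i = 0$ such that ($|A| = 1$ and $A_i = 1$) or ($|B|=1$ and $B_i=1$). Condition (N) is the negation of (M): either $\min\{|A|,|B|\}\ge 2$, or $\min\{|A|,|B|\} = 1$ and $C_i \ne 0$ for every $i$ such that ($|A|=1$ and $A_i=1$) or ($|B|=1$ and $B_i = 1$). (If (M) holds, then $f$ is locally a monomial, i.e. at every point it is a monomial times a unit in a suitable regular system of parameters.) Blowup charts: for $I\subseteq\{1,\dots,n\}$ the blowup of $\mathbb{A}^n_K$ in $V(x_i\mid i\in I)$ is covered by charts $D_+(X_j)\cong \mathbb{A}^n_K$, $j\in I$, on which it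 is given by $x_k\mapsto x_j'x_k'$ for $k\in I\setminus\{j\}$ and $x_k\mapsto x_k'$ for $k=j$ or $k\notin I$. The total transform of $f$ in the chart is its image in $K[x']$. On exponents, with $\delta := \min\{\sum_{k\in I}A_k,\sum_{k\in I}B_k\}$, one has $A'_j = \sum_{k\in I}A_k - \delta$, $B'_j=\sum_{k\in I}B_k-\delta$, $C'_j = \sum_{k\in I}C_k+\delta$, and all other entries of $A,B,C$ are unchanged. Local monomialization process: start with the chart $\mathbb{A}^n_K$ and $f$. If the data $(A,B,C)$ of a chart satisfies (M), the chart is final. Otherwise choose a center $D_I$ by the given rule applied to that chart's $(A,B,C)$ (independently of the other charts), blow up, and continue in each chart $D_+(X_j)$, $j\in I$, with the total transform $x'^{C'}(x'^{A'}-\rho x'^{B'})$. The process terminates if the resulting tree of charts is finite (so that all its leaves satisfy (M)), whatever choices of centers are made. *)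

(* Defs.v *)
From mathcomp Require Import all_boot all_order all_algebra.
From mathcomp Require Export mpoly.

Set Implicit Arguments.
Unset Strict Implicit.
Unset Printing Implicit Defensive.

Import Order.TTheory GRing.Theory.

Local Open Scope ring_scope.

(* Exponents of f = x^C (x^A - rho x^B).  The pair (A, B) is ordered: when
   rho = -1 the polynomial alone does not tell A from B. *)
Record exponents (n : nat) := Exponents {
  expA : 'X_{1..n};
  expB : 'X_{1..n};
  expC : 'X_{1..n} }.

Definition disjoint_supports n (D : exponents n) : Prop :=
  forall i : 'I_n, (expA D i * expB D i = 0)%N.

Definition poly_g (K : fieldType) n (rho : K) (D : exponents n) : {mpoly K[n]} :=
  'X_[expA D] - rho *: 'X_[expB D].

Definition poly_f (K : fieldType) n (rho : K) (D : exponents n) : {mpoly K[n]} :=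
  'X_[expC D] * poly_g rho D.

Definition max_exp n (A : 'X_{1..n}) : nat := (\max_(i < n) A i)%N.

Definition nb_max_exp n (A : 'X_{1..n}) : nat :=
  #|[set i : 'I_n | A i == max_exp A]|.

Definition iota_inv n (D : exponents n) : 4.-tuplelexi nat :=
  [tuple max_exp (expA D); nb_max_exp (expA D);
         max_exp (expB D); nb_max_exp (expB D)].

Definition condM n (D : exponents n) : bool :=
  (minn (mdeg (expA D)) (mdeg (expB D)) == 0)%N ||
  [exists i : 'I_n, (expC D i == 0)%N &&
     (((mdeg (expA D) == 1)%N && (expA D i == 1)%N) ||
      ((mdeg (expB D) == 1)%N && (expB D i == 1)%N))].

Definition condN n (D : exponents n) : bool := ~~ condM D.

(* The chart D_+(X_j) of the blowup of affine space in V(x_k | k in I) is an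
   affine space; the blowup morphism restricted to it is dual to the algebra
   morphism substituting [chart_coord I j k] for x_k. *)
Definition chart_coord (K : fieldType) n (I : {set 'I_n}) (j k : 'I_n) :
    {mpoly K[n]} :=
  if k \in I :\ j then 'X_j * 'X_k else 'X_k.

Definition total_transform (K : fieldType) n (I : {set 'I_n}) (j : 'I_n)
    (p : {mpoly K[n]}) : {mpoly K[n]} :=
  p \mPo [tuple chart_coord K I j k | k < n].

Definition set_exp n (A : 'X_{1..n}) (j : 'I_n) (e : nat) : 'X_{1..n} :=
  [multinom (if i == j then e else A i) | i < n].

Definition transform n (I : {set 'I_n}) (j : 'I_n) (D : exponents n) :
    exponents n :=
  let a := (\sum_(k in I) expA D k)%N in
  let b := (\sum_(k in I) expB D k)%N in
  let c := (\sum_(k in I) expC D k)%N in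
  let delta := minn a b in
  Exponents (set_exp (expA D) j (a - delta))
            (set_exp (expB D) j (b - delta))
            (set_exp (expC D) j (c + delta)).

(* A chart of the process is addressed by the sequence of the indices j of the
   charts D_+(X_j) leading to it, the latest first.  [center p] is the index
   set of the center chosen in the chart p, so that charts with the same
   exponents may get different centers.  [chart_at center D p] is [None] when
   there is no chart p in the tree. *)
Fixpoint chart_at n (center : seq 'I_n -> {set 'I_n}) (D : exponents n)
    (p : seq 'I_n) : option (exponents n) :=
  if p is j :: q then
    if chart_at center D q is Some E then
      if ~~ condM E && (j \in center q) then Some (transform (center q) j E)
      else None
    else None
  else Some D.

Definition follows_rule n (rule : exponents n -> {set 'I_n} -> Prop)
    (D : exponents n) (center : seq 'I_n -> {set 'I_n}) : Prop :=
  forall (p : seq 'I_n) (E : exponents n),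
    chart_at center D p = Some E -> ~~ condM E -> rule E (center p).

Definition finite_tree n (center : seq 'I_n -> {set 'I_n}) (D : exponents n) :
    Prop :=
  exists s : seq (seq 'I_n), forall p, chart_at center D p <> None -> p \in s.

Definition process_terminates n (rule : exponents n -> {set 'I_n} -> Prop)
    (D : exponents n) : Prop :=
  forall center : seq 'I_n -> {set 'I_n},
    follows_rule rule D center -> finite_tree center D.

Definition max_rule n (D : exponents n) (I : {set 'I_n}) : Prop :=
  exists j1 j2 : 'I_n,
    [/\ expA D j1 = max_exp (expA D), expB D j2 = max_exp (expB D)
      & I = [set j1; j2]].

(* Main.v *)
Require Import Defs.
From mathcomp Require Import all_boot all_order all_algebra.

Set Implicit Arguments.
Unset Strict Implicit.
Unset Printing Implicit Defensive.

Import Order.TTheory GRing.Theory.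

Local Open Scope ring_scope.

(* The center involves one index j1 where A is maximal and one index j2 where B
   is maximal; under (N) the supports are nonempty, so j1 and j2 are distinct
   and the exponent delta = min (alpha, beta) split off in each chart is
   positive.  In the chart of j1 the maximal entry alpha of A is replaced by
   alpha - delta, which lowers the maximum or its multiplicity.  In the chart of
   j2 the entry 0 of A becomes alpha - delta < alpha, which changes neither,
   while the maximal entry beta of B is replaced by beta - delta.  The process
   terminates because the lexicographic order on tuples of natural numbers is
   well-founded and every chart has finitely many successors. *)

Lemma set_expE n (A : 'X_{1..n}) (j : 'I_n) e i :
  set_exp A j e i = (if i == j then e else A i).
Proof. by rewrite mnmE. Qed.

Lemma leq_max_exp n (A : 'X_{1..n}) i : (A i <= max_exp A)%N.
Proof. exact: leq_bigmax. Qed.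

Lemma max_exp_gt0 n (A : 'X_{1..n}) : (0 < max_exp A)%N = (0 < mdeg A)%N.
Proof.
rewrite !lt0n mdeg_eq0; congr (~~ _); apply/eqP/eqP => [A0|->].
  by apply/mnmP => i; apply/eqP; rewrite mnm0E -leqn0 -A0 leq_max_exp.
by apply: big1 => i _; rewrite mnm0E.
Qed.

Lemma max_exp_attained n (A : 'X_{1..n}) :
  (0 < max_exp A)%N -> exists i, A i = max_exp A.
Proof.
case: n A => [|n] A; first by rewrite /max_exp big_ord0.
by have [|i Ai] := bigop.eq_bigmax (fun i => A i); [rewrite card_ord | exists i].
Qed.

(** No entry grows, so the maximum can only drop or stay. If it stays, [j] leaves the set of maximal
    positions and no position enters it. *)
Lemma max_exp_set_exp_lower n (A : 'X_{1..n}) j e :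
    A j = max_exp A -> (e < max_exp A)%N ->
  (max_exp (set_exp A j e) < max_exp A)%N \/
  max_exp (set_exp A j e) = max_exp A /\
    (nb_max_exp (set_exp A j e) < nb_max_exp A)%N.
Proof.
move=> Aj lt_e; have: (max_exp (set_exp A j e) <= max_exp A)%N.
  apply/bigmax_leqP => i _; rewrite set_expE.
  by case: eqP => _; [exact: ltnW | exact: leq_max_exp].
rewrite leq_eqVlt => /orP[/eqP eq_max|]; [right | by left].
split=> //; apply/proper_card/properP; split.
  apply/subsetP => i; rewrite !inE eq_max set_expE.
  by case: (i =P j) => // _ /eqP e_max; rewrite e_max ltnn in lt_e.
exists j; rewrite !inE ?Aj // eq_max set_expE eqxx.
by rewrite neq_ltn lt_e.
Qed.

(** Position [j] is not maximal before or after the change, so every maximal position lies elsewhere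
    and is untouched. *)
Lemma max_exp_set_exp_eq n (A : 'X_{1..n}) j e :
    (A j < max_exp A)%N -> (e < max_exp A)%N ->
  max_exp (set_exp A j e) = max_exp A /\
  nb_max_exp (set_exp A j e) = nb_max_exp A.
Proof.
move=> lt_Aj lt_e; have eq_max : max_exp (set_exp A j e) = max_exp A.
  apply/eqP; rewrite eqn_leq; apply/andP; split.
    apply/bigmax_leqP => i _; rewrite set_expE.
    by case: eqP => _; [exact: ltnW | exact: leq_max_exp].
  have [|i Ai] := @max_exp_attained _ A; first exact: leq_ltn_trans lt_e.
  suff <- : set_exp A j e i = max_exp A by apply: leq_max_exp.
  by rewrite set_expE; case: eqP => // eq_ij; rewrite -Ai eq_ij ltnn in lt_Aj.
split=> //; apply: eq_card => i; rewrite !inE eq_max set_expE.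
by case: (i =P j) => // ->; rewrite !ltn_eqF.
Qed.

Lemma iota_inv_ltA n (D D' : exponents n) :
    (max_exp (expA D') < max_exp (expA D))%N \/
    max_exp (expA D') = max_exp (expA D) /\
      (nb_max_exp (expA D') < nb_max_exp (expA D))%N ->
  (iota_inv D' < iota_inv D)%O.
Proof.
(* [ltxi_cons] compares the tails only under the converse head inequality, which a strict drop of
   the head refutes. *)
rewrite [(iota_inv D' < _)%O]ltxi_cons !leEnat.
case=> [lt_max|[-> lt_nb]]; first by rewrite (ltnW lt_max) leqNgt lt_max.
by rewrite leqnn ltxi_cons !leEnat (ltnW lt_nb) leqNgt lt_nb.
Qed.

Lemma iota_inv_ltB n (D D' : exponents n) :
    max_exp (expA D') = max_exp (expA D) /\
      nb_max_exp (expA D') = nb_max_exp (expA D) ->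
    (max_exp (expB D') < max_exp (expB D))%N \/
    max_exp (expB D') = max_exp (expB D) /\
      (nb_max_exp (expB D') < nb_max_exp (expB D))%N ->
  (iota_inv D' < iota_inv D)%O.
Proof.
move=> [eq_max eq_nb] ltB.
rewrite [(iota_inv D' < _)%O]ltxi_cons eq_max eq_nb ltxi_cons ltxi_cons !leEnat.
rewrite !leqnn /=.
case: ltB => [lt_max|[-> lt_nb]]; first by rewrite (ltnW lt_max) leqNgt lt_max.
by rewrite leqnn ltxi_cons !leEnat (ltnW lt_nb) leqNgt lt_nb.
Qed.

(** Only entry [j] changes, and there [delta] equals one of the two sums, so one of the new
    exponents is 0. *)
Lemma disjoint_supports_transform n (I : {set 'I_n}) j (D : exponents n) :
  disjoint_supports D -> disjoint_supports (transform I j D).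
Proof.
move=> disjD i; rewrite /= !set_expE; case: eqP => // _.
by case: leqP; rewrite subnn ?mul0n ?muln0.
Qed.

Lemma iota_inv_transform n (D : exponents n) (j1 j2 j : 'I_n) :
    disjoint_supports D -> condN D ->
    expA D j1 = max_exp (expA D) -> expB D j2 = max_exp (expB D) ->
    j \in [set j1; j2] ->
  (iota_inv (transform [set j1; j2] j D) < iota_inv D)%O.
Proof.
move=> disjD; rewrite /condN negb_or -lt0n leq_min -!max_exp_gt0 => /andP[].
move=> /andP[a_gt0 b_gt0] _ Aj1 Bj2.
have Bj1 : expB D j1 = 0%N.
  by have /eqP := disjD j1; rewrite Aj1 muln_eq0 eqn0Ngt a_gt0 => /eqP.
have Aj2 : expA D j2 = 0%N.
  by have /eqP := disjD j2; rewrite Bj2 muln_eq0 orbC eqn0Ngt b_gt0 => /eqP.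
have neq_j : j1 != j2.
  by apply: contraTneq b_gt0 => eq_j; rewrite -Bj2 -eq_j Bj1.
have sumE (F : 'I_n -> nat) : (\sum_(k in [set j1; j2]) F k = F j1 + F j2)%N.
  by rewrite big_setU1 ?inE //= big_set1.
(* Subtraction is truncated, so a strict drop needs [m] positive as well as [delta]. *)
have lt_sub m : (0 < m ->
    m - minn (max_exp (expA D)) (max_exp (expB D)) < m)%N.
  by move=> m_gt0; rewrite ltn_subrL m_gt0 leq_min a_gt0 b_gt0.
rewrite /transform !sumE Aj1 Bj1 Aj2 Bj2 addn0 add0n.
rewrite !inE => /orP[] /eqP ->.
  by apply: iota_inv_ltA; apply: max_exp_set_exp_lower => //; apply: lt_sub.
apply: iota_inv_ltB.
  by apply: max_exp_set_exp_eq; rewrite ?Aj2 //; apply: lt_sub.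
by apply: max_exp_set_exp_lower => //; apply: lt_sub.
Qed.

(** Each [k] in [I :\ j] contributes an extra factor ['X_j ^+ A k]; together with ['X_j ^+ A j]
    these give the sum over [I]. *)
Lemma total_transformX (K : fieldType) n (I : {set 'I_n}) j (A : 'X_{1..n}) :
    j \in I ->
  total_transform I j ('X_[A] : {mpoly K[n]})
    = 'X_[set_exp A j (\sum_(k in I) A k)].
Proof.
move=> Ij; rewrite /total_transform comp_mpolyX.
have -> : \prod_(i < n) tnth [tuple chart_coord K I j k | k < n] i ^+ A i
    = (\prod_(i < n) (if i \in I :\ j then 'X_j else 1) ^+ A i)
      * \prod_(i < n) 'X_i ^+ A i :> {mpoly K[n]}.
  rewrite -big_split; apply: eq_bigr => i _ /=.
  rewrite tnth_mktuple /chart_coord.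
  by case: ifP => _; rewrite ?exprMn ?expr1n ?mul1r.
rewrite [RHS]mpolyXE_id (bigD1 j) //= [RHS](bigD1 j) //= set_expE eqxx.
have -> : \prod_(i < n | i != j) 'X_i ^+ set_exp A j (\sum_(k in I) A k) i
    = \prod_(i < n | i != j) 'X_i ^+ A i :> {mpoly K[n]}.
  by apply: eq_bigr => i /negPf ne_ij; rewrite set_expE ne_ij.
rewrite setD11 expr1n mul1r [X in _ * X](bigD1 j) //= mulrA; congr (_ * _).
rewrite mulrC (big_setD1 j Ij) exprD; congr (_ * _).
rewrite -prodrXr big_mkcond [RHS]big_mkcond; apply: eq_bigr => i _.
by rewrite in_setD1; case: (i != j); case: (i \in I); rewrite ?expr1n.
Qed.

Lemma mpolyX_set_exp (K : fieldType) n (A : 'X_{1..n}) j d e :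
  'X_[set_exp A j (d + e)] = 'X_[(U_( j) *+ d)%MM] * 'X_[set_exp A j e]
    :> {mpoly K[n]}.
Proof.
rewrite -mpolyXD; congr 'X_[_]; apply/mnmP => i.
rewrite mnmDE mulmnE mnm1E !set_expE eq_sym.
by case: eqP; rewrite ?mul1n ?mul0n.
Qed.

(** The power of ['X_j] with exponent [delta] divides the transforms of both monomials of [g]; it is
    pulled out and absorbed into the factor with exponent [expC]. *)
Lemma total_transform_poly_f (K : fieldType) n (rho : K) (I : {set 'I_n}) j
    (D : exponents n) :
  j \in I -> total_transform I j (poly_f rho D) = poly_f rho (transform I j D).
Proof.
move=> Ij; rewrite /poly_f /poly_g.
have -> : total_transform I j ('X_[expC D] * ('X_[expA D] - rho *: 'X_[expB D]))
    = total_transform I j 'X_[expC D] * (total_transform I j 'X_[expA D]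
        - rho *: total_transform I j 'X_[expB D]).
  by rewrite /total_transform rmorphM rmorphB /= comp_mpolyZ.
rewrite !total_transformX //=.
set a := (\sum_(k in I) expA D k)%N; set b := (\sum_(k in I) expB D k)%N.
have -> : set_exp (expA D) j a = set_exp (expA D) j (minn a b + (a - minn a b)).
  by rewrite subnKC ?geq_minl.
have -> : set_exp (expB D) j b = set_exp (expB D) j (minn a b + (b - minn a b)).
  by rewrite subnKC ?geq_minr.
rewrite [(_ + minn a b)%N]addnC !mpolyX_set_exp scalerAr -mulrBr.
by rewrite mulrCA !mulrA.
Qed.

Lemma tuplelexi_nat_wf n : well_founded (fun s t : n.-tuplelexi nat => (s < t)%O).
Proof.
elim: n => [|n IHn] t.
  by apply: Acc_intro => s; rewrite (tuple0 s) (tuple0 t) ltxx.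
(* The tail stays general in the outer induction, since it may grow arbitrarily when the head
   drops. *)
case/tupleP: t => x t; elim/ltn_ind: x t => x IHx t.
elim/(well_founded_ind IHn): t => t IHt; apply: Acc_intro => s.
case/tupleP: s => y s; rewrite [(_ < _)%O]ltxi_cons !leEnat => /andP[].
rewrite leq_eqVlt => /orP[/eqP -> | lt_yx _]; last exact: IHx.
by rewrite leqnn => lt_st; apply: IHt.
Qed.

(* Charts are addressed with the latest index first, so the subtree at the first
   chart j consists of the addresses [rcons p j]. *)
Lemma chart_at_rcons n center (D : exponents n) p j :
  chart_at center D (rcons p j) =
    if ~~ condM D && (j \in center [::]) then
      chart_at (fun q => center (rcons q j)) (transform (center [::]) j D) p
    else None.
Proof.
elim: p => [|i p IHp] //=.
by rewrite IHp; case: ifP.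
Qed.

(** [P] is an invariant of the charts and [mu] a measure decreasing along each edge. By well-founded
    induction the subtrees at the children are finite, and there are finitely many of them. *)
Lemma process_terminates_wf n (rule : exponents n -> {set 'I_n} -> Prop)
    (P : exponents n -> Prop) (T : Type) (R : T -> T -> Prop)
    (mu : exponents n -> T) :
    well_founded R ->
    (forall D I j, P D -> ~~ condM D -> rule D I -> j \in I ->
       P (transform I j D) /\ R (mu (transform I j D)) (mu D)) ->
  forall D, P D -> process_terminates rule D.
Proof.
move=> R_wf step D; have [t mu_t] : exists t, mu D = t by exists (mu D).
elim/(well_founded_ind R_wf): t D mu_t => t IHt D mu_t PD center ruleD.
rewrite -{t}mu_t in IHt.
have subtree j : exists s : seq (seq 'I_n),
    forall p, chart_at center D (rcons p j) <> None -> p \in s.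
  have [/andP[notM Ij]|stop] := boolP (~~ condM D && (j \in center [::])).
    have [PD' RD'] := step D (center [::]) j PD notM (ruleD [::] D erefl notM) Ij.
    (* The subtree at [j] is itself a process tree, with the choice of centers restricted to
       addresses starting at [j]. *)
    have [p E chartE|s sP] := IHt _ RD' _ erefl PD' (fun q => center (rcons q j)).
      by apply: ruleD; rewrite chart_at_rcons notM Ij.
    by exists s => p; rewrite chart_at_rcons notM Ij; apply: sP.
  by exists [::] => p; rewrite chart_at_rcons (negPf stop).
(* Finite choice over ['I_n] picks one list per subtree; the root and these lists, extended by [j],
   cover the tree. *)
have [s sP] := fin_all_exists subtree.
exists ([::] :: [seq rcons p j | j <- enum 'I_n, p <- s j]).
elim/last_ind => [|p j _] chart_p; first exact: mem_head.
rewrite in_cons; apply/orP; right.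
by apply/allpairsPdep; exists j, p; rewrite mem_enum; split=> //; apply: sP.
Qed.

Lemma max_rule_terminates n (D : exponents n) :
  disjoint_supports D -> process_terminates (@max_rule n) D.
Proof.
apply: (process_terminates_wf (@tuplelexi_nat_wf 4) (mu := @iota_inv n)).
move=> E I j disjE notM [j1 [j2 [Aj1 Bj2 ->]]] Ij.
by split; [exact: disjoint_supports_transform | exact: iota_inv_transform].
Qed.

Theorem proposition4p5 (K : fieldType) (n : nat) (rho : K) (A B C : 'X_{1..n})
    (hrho : rho != 0) (hAB : forall i : 'I_n, (A i * B i = 0)%N) :
  (condN (Exponents A B C) ->
   forall j1 j2 : 'I_n, A j1 = max_exp A -> B j2 = max_exp B ->
   forall j : 'I_n, j \in [set j1; j2] ->
   let D' := transform [set j1; j2] j (Exponents A B C) in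
   [/\ total_transform [set j1; j2] j (poly_f rho (Exponents A B C))
         = poly_f rho D',
       disjoint_supports D'
     & (iota_inv D' < iota_inv (Exponents A B C))%O]) /\
  process_terminates (@max_rule n) (Exponents A B C).
Proof.
split=> [notM j1 j2 Aj1 Bj2 j Ij D'|]; last exact: max_rule_terminates.
split.
- exact: total_transform_poly_f.
- exact: disjoint_supports_transform.
- exact: iota_inv_transform.
Qed.
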